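(* For every multi-urn search problem (with arbitrary dependence among the events $A_i$, $i\in\mathcal V$), there exists an optimal policy, i.e. a valid policy minimizing $\mathbb{E}[C]$ among all valid policies, that is a block policy.
   Context: Multi-urn search problem. Let $\mathcal V$ be a finite nonempty set of urns. Urn $i\in\mathcal V$ contains $N_i\ge 1$ marbles ($N_i$ a known integer), at most one of which is red; all other marbles are blue. Let $A_i$ be the event that urn $i$ contains a red marble. For $U\subseteq\mathcal V$ put $\varphi_U=\mathbb P(\bigcap_{i\in U}A_i)$, with $\varphi_\emptyset=1$ and $\varphi_i=\varphi_{\{i\}}$; it is assumed that $\varphi_i>0$ for all $i$. The joint law of $(A_i)_{i\in\mathcal V}$ is arbitrary otherwise. Marbles are drawn from each urn in uniformly random order without replacement: given which urns contain a red marble, the position of the red marble in the draw order of each such urn $i$ is uniform on $\{1,\dots,N_i\}$, and these positions are independent across urns. Let $N=\sum_{i\in\mathcal V}N_i$. A valid policy is a sequence $\mathbf u=(u(0),\dots,u(N-1))$ of elements of $\mathcal V$ with $|\{t:u(t)=i\}|=N_i$ for every $i\in\mathcal V$. The search following $\mathbf u$ draws, at each stage $t=0,1,\dots$, one marble from urn $u(t)$, discards it if it is blue, and stops as soon as a red marble is drawn or all urns are empty. The cost $C\in\{0,1,\dots,N\}$ is the number of blue marbles drawn in the search (so $C=N$ if there is no red marble). A valid policy is optimal if it minimizes $\mathbb E[C]$ over all valid policies. A block policy is a valid policy in which each urn is queried exhaustively before another urn is queried; i.e. there is an ordering $(v^1,\dots,v^{|\mathcal V|})$ of the urns in $\mathcal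 V$ such that $u(t)=v^i$ whenever $\sum_{j=1}^{i-1}N_{v^j}\le t<\sum_{j=1}^{i}N_{v^j}$. *)

(* Defs.v *)
(* MathComp / MathComp-Analysis *)
From mathcomp Require Import all_boot all_order all_algebra.
From mathcomp Require Import all_classical all_reals all_analysis.

Set Implicit Arguments.
Unset Strict Implicit.
Unset Printing Implicit Defensive.

Import Order.TTheory GRing.Theory Num.Theory.

Local Open Scope classical_set_scope.
Local Open Scope ring_scope.

(* P(B | E); only meaningful when P E > 0. *)
Definition cond_prob (d : measure_display) (T : measurableType d)
    (R : realType) (P : probability T R) (E B : set T) : R :=
  fine (P (B `&` E)) / fine (P E).

(* The event that the urns containing a red marble are exactly those in U. *)
Definition red_urns (T : Type) (V : finType) (A : V -> set T) (U : {set V}) :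
    set T :=
  [set w | forall i, A i w <-> i \in U].

(* [red_pos i w] is the rank (from 1 to [urn_size i]) of the red marble in the
   draw order of urn i; it is irrelevant, and unconstrained, outside of the
   event [has_red i]. *)
Record urn_problem (d : measure_display) (T : measurableType d)
    (R : realType) (P : probability T R) (V : finType) := UrnProblem {
  urn_size : V -> nat;
  has_red : V -> set T;
  red_pos : V -> T -> nat;
  urns_nonempty : (0 < #|V|)%N;
  urn_size_gt0 : forall i, (0 < urn_size i)%N;
  measurable_has_red : forall i, measurable (has_red i);
  has_red_gt0 : forall i, (0 < P (has_red i))%E;
  measurable_red_pos : forall i, measurable_fun (has_red i) (red_pos i);
  red_pos_range : forall i w, has_red i w ->
    (1 <= red_pos i w <= urn_size i)%N;
  red_pos_uniform : forall (U : {set V}) (i : V) (k : nat),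
    (0 < P (red_urns has_red U))%E -> i \in U -> (1 <= k <= urn_size i)%N ->
    cond_prob P (red_urns has_red U) [set w | red_pos i w = k]
      = ((urn_size i)%:R)^-1;
  red_pos_indep : forall (U : {set V}) (B : V -> set nat),
    (0 < P (red_urns has_red U))%E ->
    cond_prob P (red_urns has_red U)
      [set w | forall i, i \in U -> B i (red_pos i w)]
      = \prod_(i in U)
          cond_prob P (red_urns has_red U) [set w | B i (red_pos i w)]
}.

Section Policies.
Context (d : measure_display) (T : measurableType d) (R : realType)
  (P : probability T R) (V : finType) (M : urn_problem P V).

Definition nb_marbles : nat := (\sum_(i : V) urn_size M i)%N.

Definition policy : Type := {ffun 'I_nb_marbles -> V}.

Definition valid_policy (u : policy) : Prop :=
  forall i : V, #|[pred t | u t == i]| = urn_size M i.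

(* How many marbles have been drawn from urn [u t] once stage t is over. *)
Definition draw_rank (u : policy) (t : 'I_nb_marbles) : nat :=
  #|[pred s : 'I_nb_marbles | (s <= t)%N && (u s == u t)]|.

Definition draws_red (u : policy) (w : T) (t : 'I_nb_marbles) : bool :=
  (w \in has_red M (u t)) && (red_pos M (u t) w == draw_rank u t).

Definition reaches (u : policy) (w : T) (t : 'I_nb_marbles) : bool :=
  [forall s : 'I_nb_marbles, (s < t)%N ==> ~~ draws_red u w s].

Definition cost (u : policy) (w : T) : nat :=
  #|[pred t | reaches u w t && ~~ draws_red u w t]|.

Definition expected_cost (u : policy) : \bar R :=
  'E_P[fun w => (cost u w)%:R].

Definition optimal_policy (u : policy) : Prop :=
  valid_policy u /\
  forall u' : policy, valid_policy u' ->
    (expected_cost u <= expected_cost u')%E.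

Definition block_policy (u : policy) : Prop :=
  valid_policy u /\
  exists v : 'I_#|V| -> V, bijective v /\
    forall (i : 'I_#|V|) (t : 'I_nb_marbles),
      (\sum_(j < #|V| | j < i) urn_size M (v j) <= t
         < \sum_(j < #|V| | j <= i) urn_size M (v j))%N ->
      u t = v i.

End Policies.

(* Main.v *)
Require Import Defs.
From mathcomp Require Import all_boot all_order all_algebra.
From mathcomp Require Import all_classical all_reals all_analysis.
From mathcomp Require Import measurable_realfun lra zify.

(** Write a policy as the word of the urns it queries, and let q(s) be the
    probability that the draws prescribed by the word s are all blue.  The
    search is still running after t draws exactly when the first t draws are
    blue, so the expected cost of a word is the sum of q over its nonempty
    prefixes (expected_costE, search_cost).

    The value q(s) depends only on how often each urn occurs in s, and appending
    one more query of i lowers it by the probability that this very query finds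
    the red marble of i while the other urns have shown nothing.  As the position
    of that marble is uniform and independent of the other positions once the set
    of red urns is given, the drop does not depend on how often i occurs in s;
    and it can only shrink when other urns are queried more often
    (no_red_prob_diminishing).

    Suppose now that i is queried in two runs separated by a word m, as in
    p i^a m i^c r, and slide m through the queries of i: consider the words
    p i^x m i^(a+c-x) r for x between 0 and a+c.  Passing from x to x+1 replaces
    m i by i m after p i^x.  The draws of m are then made with one more query of
    i done beforehand, which lowers the cost by a sum of drops of i that is the
    same for every x; and one draw of i is made before m instead of after it,
    which changes the cost by q(p i^(x+1)) - q(p i^x m i).  The latter does not
    increase with x, since q decreases faster along queries of i when m has not
    been drawn.  Hence the cost is a concave function of x
    (swap_gain_noninc), and by concave_min_at_ends one of the two extreme words,
    where the two runs are merged, costs no more than the original word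
    (merge_runs).  Each merge lowers the number of runs, so every word is
    dominated by one in which each urn forms a single run, i.e. by a block word
    (exists_block_word_le).  There are finitely many valid policies; applying
    this to a cheapest one gives the theorem. *)

Set Implicit Arguments.
Unset Strict Implicit.
Unset Printing Implicit Defensive.

Import Order.TTheory GRing.Theory Num.Theory.
Local Open Scope classical_set_scope.
Local Open Scope ring_scope.

(** * Discrete concavity *)

(** If F takes a value below F 0 before a, some increment before a is negative;
    by concavity all later increments are negative as well, up to L. *)
Lemma concave_min_at_ends (R : realDomainType) (F : nat -> R) (L a : nat) :
  (forall x, (x.+2 <= L)%N -> F x.+2 - F x.+1 <= F x.+1 - F x) ->
  (a <= L)%N -> F 0%N <= F a \/ F L <= F a.
Proof.
move=> conc.
have step x y : (x < y)%N -> (y < L)%N -> F y.+1 - F y <= F x.+1 - F x.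
  elim: y => // y IH; rewrite ltnS leq_eqVlt => /predU1P[->|xy] yL.
    exact: conc.
  by apply: le_trans (conc _ yL) (IH xy (ltnW yL)).
case: (leP (F 0%N) (F a)) => [|Fa0 aL]; first by left.
right.
have [x xa Fx] : exists2 x, (x < a)%N & F x.+1 < F x.
  elim: a Fa0 {aL} => [|a IH]; first by rewrite ltxx.
  case: (ltP (F a.+1) (F a)) => [|Faa1 Fa0]; first by exists a.
  by have [x xa] := IH (le_lt_trans Faa1 Fa0); exists x => //; apply: ltnW.
suff noninc y : (a <= y <= L)%N -> F y <= F a.
  by apply: noninc; rewrite aL leqnn.
elim: y => [|y IH]; first by rewrite leqn0 => /andP[/eqP-> _].
case/andP; rewrite leq_eqVlt => /predU1P[->//|]; rewrite ltnS => ay yL.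
have := step x y (leq_trans xa ay) yL.
have := IH (introT andP (conj ay (ltnW yL))).
lra.
Qed.

(** * Merging the runs of a word *)

Section Words.
Context (R : realDomainType) (V : eqType) (q : seq V -> R).
Implicit Types (p s m r : seq V) (i : V).

(** The cost of the draws s when those of p have been made before; the sum
    starts with the prefix of length one since the cost counts the stages that
    end without a red marble. *)
Definition search_cost p s : R := \sum_(t < size s) q (p ++ take t.+1 s).

Lemma search_cost_nil p : search_cost p [::] = 0.
Proof. exact: big_ord0. Qed.

Lemma search_cost_cons p i s :
  search_cost p (i :: s) = q (rcons p i) + search_cost (rcons p i) s.
Proof.
rewrite /search_cost big_ord_recl /= take0 cats1; congr (_ + _).
by apply: eq_bigr => t _; rewrite cat_rcons.
Qed.

Lemma search_cost_cat p s r :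
  search_cost p (s ++ r) = search_cost p s + search_cost (p ++ s) r.
Proof.
elim: s p => [|i s IH] p; first by rewrite search_cost_nil add0r cats0.
by rewrite /= !search_cost_cons IH cat_rcons addrA.
Qed.

Context (q_perm : forall s s', perm_eq s s' -> q s = q s').

Lemma search_cost_perm p p' s :
  perm_eq p p' -> search_cost p s = search_cost p' s.
Proof.
by move=> pp'; apply: eq_bigr => t _; apply: q_perm; rewrite perm_cat2r.
Qed.

Context (N : V -> nat).

(** For a q that depends on occurrence counts, this says two things at once.
    With equal counts away from i, used in both directions, the drop does not
    depend on the number of queries of i, so that q is affine in it; with larger
    counts away from i the drop is smaller, so that the mixed second differences
    of q are nonnegative. *)
Context (diminishing_drop : forall i s s',
  (count_mem i s < N i)%N -> (count_mem i s' < N i)%N ->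
  (forall j, j != i -> count_mem j s <= count_mem j s')%N ->
  q s' - q (rcons s' i) <= q s - q (rcons s i)).

(** Replacing m i by i m after p changes the cost by minus the drops of i after p
    followed by the nonempty prefixes of m, plus q(p i) - q(p m i).  One more
    query of i in p leaves the former unchanged, and changes the latter by the
    difference between the drops of i after p m i and after p i, which is
    nonpositive. *)
Lemma swap_gain_noninc p i m :
  (count_mem i p + count_mem i m + 2 <= N i)%N ->
  search_cost (rcons p i) (i :: m) - search_cost (rcons p i) (rcons m i) <=
  search_cost p (i :: m) - search_cost p (rcons m i).
Proof.
move=> hN.
have mid : search_cost (rcons (rcons p i) i) m - search_cost (rcons p i) m <=
           search_cost (rcons p i) m - search_cost p m.
  rewrite /search_cost -!sumrB; apply: ler_sum => t _.
  set s := take _ _.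
  have hs : (count_mem i s <= count_mem i m)%N.
    by rewrite -[in leqRHS](cat_take_drop t.+1 m) count_cat leq_addr.
  have -> : q (rcons (rcons p i) i ++ s) = q (rcons (rcons (p ++ s) i) i).
    by apply: q_perm; apply/permP => x; rewrite -!cats1 !count_cat /=; lia.
  have -> : q (rcons p i ++ s) = q (rcons (p ++ s) i).
    by apply: q_perm; apply/permP => x; rewrite -!cats1 !count_cat /=; lia.
  rewrite -lerN2 !opprB; apply: diminishing_drop => [||j ji];
    rewrite -?cats1 !count_cat /= ?eqxx ?addn0; [lia|lia|].
  by rewrite eq_sym (negPf ji); lia.
have ends : q (rcons (p ++ m) i) - q (rcons (rcons p i ++ m) i) <=
            q (rcons p i) - q (rcons (rcons p i) i).
  have -> : q (rcons (rcons p i ++ m) i) = q (rcons (rcons (p ++ m) i) i).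
    by apply: q_perm; apply/permP => x; rewrite -!cats1 !count_cat /=; lia.
  apply: diminishing_drop => [||j ji];
    rewrite -?cats1 !count_cat /= ?eqxx ?addn0; [lia|lia|].
  by rewrite eq_sym (negPf ji); lia.
rewrite -(cats1 m) !search_cost_cat !search_cost_cons.
rewrite !search_cost_nil; lra.
Qed.

(** The middle word m is moved through the a + c queries of i; the cost is
    concave in the number x of queries made before m, hence minimal at x = 0 or
    at x = a + c. *)
Lemma merge_runs p i a m c r :
  (forall j, count_mem j (p ++ nseq a i ++ m ++ nseq c i ++ r) <= N j)%N ->
  let s := p ++ nseq a i ++ m ++ nseq c i ++ r in
  search_cost [::] (p ++ m ++ nseq (a + c) i ++ r) <= search_cost [::] s \/
  search_cost [::] (p ++ nseq (a + c) i ++ m ++ r) <= search_cost [::] s.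
Proof.
move=> /(_ i); rewrite !count_cat !count_nseq /= eqxx !mul1n => hN.
pose L := (a + c)%N.
pose F x := search_cost [::] (p ++ nseq x i ++ m ++ nseq (L - x) i ++ r).
(* Only the exchange of m i for i m after p i^x distinguishes F x.+1 from F x. *)
have FE x : (x < L)%N -> F x.+1 - F x =
    search_cost (p ++ nseq x i) (i :: m) -
    search_cost (p ++ nseq x i) (rcons m i).
  move=> xL; rewrite /F.
  have -> : (L - x = (L - x.+1).+1)%N by lia.
  have -> : p ++ nseq x.+1 i ++ m ++ nseq (L - x.+1) i ++ r =
      (p ++ nseq x i) ++ (i :: m) ++ nseq (L - x.+1) i ++ r.
    by rewrite -addn1 nseqD -!catA.
  have -> : p ++ nseq x i ++ m ++ nseq (L - x.+1).+1 i ++ r =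
      (p ++ nseq x i) ++ rcons m i ++ nseq (L - x.+1) i ++ r.
    by rewrite -cats1 -!catA.
  move: (p ++ nseq x i) (nseq _ _ ++ r) => p' r'.
  rewrite !search_cost_cat !cat0s.
  rewrite (search_cost_perm r' (p' := p' ++ rcons m i)); last first.
    by rewrite perm_cat2l -cats1 -cat1s perm_catC.
  lra.
have conc x : (x.+2 <= L)%N -> F x.+2 - F x.+1 <= F x.+1 - F x.
  move=> xL; rewrite !FE; [|lia|lia].
  have -> : p ++ nseq x.+1 i = rcons (p ++ nseq x i) i.
    by rewrite -addn1 nseqD catA cats1.
  apply: swap_gain_noninc; rewrite count_cat count_nseq /= eqxx mul1n.
  rewrite /L in xL; lia.
have := concave_min_at_ends conc (leq_addr c a : (a <= L)%N).
by rewrite /F subn0 subnn {1 3}/L addKn.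
Qed.

(** Adjacent runs of the same urn and empty runs are allowed, so every list of
    pairs is a legitimate encoding and merging two runs always makes the list
    shorter. *)
Definition expand_runs (rl : seq (V * nat)) : seq V :=
  flatten [seq nseq b.2 b.1 | b <- rl].

Lemma expand_runs_cat rl rl' :
  expand_runs (rl ++ rl') = expand_runs rl ++ expand_runs rl'.
Proof. by rewrite /expand_runs map_cat flatten_cat. Qed.

Lemma expand_runs_cons i n rl :
  expand_runs ((i, n) :: rl) = nseq n i ++ expand_runs rl.
Proof. by []. Qed.

Lemma expand_runs1 s : expand_runs [seq (i, 1%N) | i <- s] = s.
Proof. by elim: s => //= i s IH; rewrite expand_runs_cons IH. Qed.

Lemma not_uniq_runs (rl : seq (V * nat)) : ~~ uniq [seq b.1 | b <- rl] ->
  exists i a c (p m r : seq (V * nat)), rl = p ++ (i, a) :: m ++ (i, c) :: r.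
Proof.
elim: rl => // -[i a] rl IH /=; rewrite negb_and negbK.
case/orP => [/mapP[[j c] /splitPr[m r] /= ->]|/IH].
  by exists j, a, c, [::], m, r.
by move=> [j [a' [c [p [m [r ->]]]]]]; exists j, a', c, ((i, a) :: p), m, r.
Qed.

Lemma merge_all_runs rl :
  (forall j, count_mem j (expand_runs rl) <= N j)%N ->
  exists rl', [/\ uniq [seq b.1 | b <- rl'],
    perm_eq (expand_runs rl') (expand_runs rl) &
    search_cost [::] (expand_runs rl') <= search_cost [::] (expand_runs rl)].
Proof.
have [n] := ubnP (size rl); elim: n rl => // n IH rl szn hN.
have [u|/not_uniq_runs] := boolP (uniq [seq b.1 | b <- rl]).
  by exists rl; split.
move=> [i [a [c [p [m [r rlE]]]]]]; subst rl.
suff [rl' [sz pe le]] : exists rl', [/\ (size rl' < n)%N,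
    perm_eq (expand_runs rl') (expand_runs (p ++ (i, a) :: m ++ (i, c) :: r)) &
    search_cost [::] (expand_runs rl') <=
    search_cost [::] (expand_runs (p ++ (i, a) :: m ++ (i, c) :: r))].
  have [|rl'' [u pe' le']] := IH rl' sz.
    by move=> j; rewrite (permP pe).
  exists rl''; split => //; first exact: perm_trans pe' pe.
  exact: le_trans le' le.
have E : expand_runs (p ++ (i, a) :: m ++ (i, c) :: r) = expand_runs p ++
    nseq a i ++ expand_runs m ++ nseq c i ++ expand_runs r.
  by rewrite !(expand_runs_cat, expand_runs_cons).
move: szn hN; rewrite E !size_cat /= size_cat /= => szn hN.
have [le|le] := merge_runs hN.
  exists (p ++ m ++ (i, a + c)%N :: r); split.
  - by rewrite !size_cat /=; lia.
  - rewrite !(expand_runs_cat, expand_runs_cons) perm_cat2l nseqD.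
    rewrite -catA perm_catCA.
    by rewrite perm_cat2l !perm_cat2l.
  - by rewrite !(expand_runs_cat, expand_runs_cons).
exists (p ++ (i, a + c)%N :: m ++ r); split.
- by rewrite !size_cat /= !size_cat; lia.
- rewrite !(expand_runs_cat, expand_runs_cons) perm_cat2l nseqD.
  rewrite -catA perm_cat2l.
  by rewrite perm_catCA.
- by rewrite !(expand_runs_cat, expand_runs_cons).
Qed.

Lemma count_expand_runs rl i n : uniq [seq b.1 | b <- rl] -> (i, n) \in rl ->
  count_mem i (expand_runs rl) = n.
Proof.
elim: rl => // -[j k] rl IH /= /andP[jrl u].
rewrite expand_runs_cons count_cat count_nseq /= in_cons xpair_eqE.
have notin l : i \notin [seq b.1 | b <- l] -> count_mem i (expand_runs l) = 0%N.
  elim: l => // -[j' k'] l IHl /=; rewrite in_cons negb_or => /andP[ij /IHl].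
  by rewrite expand_runs_cons count_cat count_nseq /= eq_sym (negPf ij) => ->.
case/orP => [/andP[/eqP ij /eqP->]|ril].
  by rewrite -ij eqxx mul1n notin ?addn0 // ij.
rewrite (IH u ril) (_ : (j == i) = false) //.
apply: contraNF jrl => /eqP->; exact: (map_f (fun b => b.1) ril).
Qed.

Definition block_word (vs : seq V) : seq V :=
  flatten [seq nseq (N v) v | v <- vs].

Lemma block_word_runs vs : block_word vs = expand_runs [seq (v, N v) | v <- vs].
Proof. by rewrite /block_word /expand_runs -map_comp. Qed.

Lemma count_block_word vs i : uniq vs -> i \in vs ->
  count_mem i (block_word vs) = N i.
Proof.
move=> u ivs; rewrite block_word_runs; apply: count_expand_runs.
  by rewrite -map_comp map_id.
by apply/mapP; exists i.
Qed.

(** Starting from the encoding of s by runs of length one, merging leaves one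
    run per urn; the counts force the run of i to have length N i, and every urn
    occurs since N i > 0. *)
Lemma exists_block_word_le s :
  (forall i, 0 < N i)%N -> (forall i, count_mem i s = N i) ->
  exists vs, [/\ uniq vs, forall i, i \in vs &
    search_cost [::] (block_word vs) <= search_cost [::] s].
Proof.
move=> N0 cs.
have [|rl [u pe le]] := @merge_all_runs [seq (i, 1%N) | i <- s].
  by move=> j; rewrite expand_runs1 cs.
rewrite expand_runs1 in pe le.
have cE i : count_mem i (expand_runs rl) = N i by rewrite (permP pe) cs.
exists [seq b.1 | b <- rl]; split => // [i|].
  have : i \in expand_runs rl by rewrite -has_pred1 has_count cE.
  move=> /flattenP[_ /mapP[r rrl ->]]; rewrite mem_nseq => /andP[_ /eqP->].
  exact: map_f.
rewrite block_word_runs -map_comp (_ : map _ _ = rl) //.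
rewrite -[RHS]map_id; apply/eq_in_map => -[i n] irl /=.
by rewrite -cE (count_expand_runs u irl).
Qed.

End Words.

(** * Prefixes of words and enumerations *)

Lemma take_enum_ord n k : (k <= n)%N ->
  take k (enum 'I_n) = [seq r : 'I_n <- enum 'I_n | (r < k)%N].
Proof.
move=> kn; apply: (inj_map val_inj).
transitivity [seq j <- map val (enum 'I_n) | (j < k)%N]; last exact: filter_map.
rewrite map_take val_enum_ord take_iota (minn_idPl kn).
by rewrite -[LHS](filter_iota_ltn 0 kn).
Qed.

Lemma count_reached (V : eqType) (s : seq V) (i : V) (k : nat) :
  (1 <= k <= count_mem i s)%N ->
  exists t, [/\ (t < size s)%N, nth i s t = i & count_mem i (take t.+1 s) = k].
Proof.
elim/last_ind: s => [|s x IH]; first by rewrite leqn0 andbC; case: k.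
rewrite -cats1 count_cat /= addn0 => /andP[k1].
have [ks _|sk kle] := leqP k (count_mem i s).
  have [|t [ts nt ct]] := IH; first by rewrite k1.
  exists t; rewrite size_cat nth_cat take_cat ts; split => //.
    exact: ltn_addr.
  rewrite -ct; case: ltnP => // st.
  by rewrite (_ : _ - _ = 0)%N ?take0 ?cats0 ?take_oversize //; lia.
have xi : x = i.
  by apply/eqP; move: kle; case: (x == i) => //; rewrite addn0 leqNgt sk.
move: kle; rewrite xi eqxx addn1 => kle; exists (size s).
rewrite size_cat /= addn1 ltnSn nth_cat ltnn subnn /=.
rewrite take_oversize ?size_cat /= ?addn1 // count_cat /= eqxx.
by split=> //; apply/eqP; rewrite addn1 eqn_leq sk.
Qed.

Lemma nth_block_word (V : eqType) (N : V -> nat) (v0 : V) (vs : seq V)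
    (i t : nat) : (i < size vs)%N ->
  (\sum_(v <- take i vs) N v <= t < \sum_(v <- take i.+1 vs) N v)%N ->
  nth v0 (block_word N vs) t = nth v0 vs i.
Proof.
move=> ivs; rewrite (take_nth v0 ivs) -cats1 big_cat big_seq1 /=.
move=> /andP[le lt].
have szb (l : seq V) : size (block_word N l) = (\sum_(v <- l) N v)%N.
  elim: l => [|v l IH]; first by rewrite big_nil.
  by rewrite big_cons -IH /block_word /= size_cat size_nseq.
have -> : block_word N vs = block_word N (take i vs) ++
    nseq (N (nth v0 vs i)) (nth v0 vs i) ++ block_word N (drop i.+1 vs).
  rewrite -{1}(cat_take_drop i vs) (drop_nth v0 ivs).
  by rewrite /block_word map_cat flatten_cat.
rewrite nth_cat szb ltnNge le /= nth_cat size_nseq.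
have -> : (t - \sum_(v <- take i vs) N v < N (nth v0 vs i))%N by lia.
by rewrite nth_nseq; case: ifP => //; lia.
Qed.

(** * The probability that given draws are all blue *)

Lemma measurable_forall (d : measure_display) (T : measurableType d)
    (V : finType) (F : V -> set T) :
  (forall i, measurable (F i)) -> measurable [set w | forall i, F i w].
Proof.
move=> mF; rewrite (_ : [set _ | _] = \bigcap_(i in setT) F i); last first.
  by apply/seteqP; split => w /= Fw i; [move=> _|]; exact: Fw.
by apply: fin_bigcap_measurable => //; exact: finite_finset.
Qed.

Section Urns.
Context (d : measure_display) (T : measurableType d) (R : realType)
  (P : probability T R) (V : finType) (M : urn_problem P V).
Implicit Types (i j : V) (s : seq V) (U : {set V}).

Definition no_red s : set T :=
  [set w | forall i, has_red M i w -> (count_mem i s < red_pos M i w)%N].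

(** With k one more than the number of queries of i in s, the event that the
    next query of i finds the first red marble.  It is defined for any k because
    its probability is to be compared for different values of k. *)
Definition red_next i k s : set T :=
  [set w | [/\ has_red M i w, red_pos M i w = k &
    forall j, j != i -> has_red M j w -> (count_mem j s < red_pos M j w)%N]].

Lemma measurable_red_in i (B : set nat) :
  measurable [set w | has_red M i w -> B (red_pos M i w)].
Proof.
rewrite (_ : [set _ | _] =
  ~` has_red M i `|` (has_red M i `&` red_pos M i @^-1` B)); last first.
  apply/seteqP; split => w /=; last by case=> [//|[]].
  by move=> AB; have [/[dup] Aw /AB|] := pselect (has_red M i w); [right|left].
have mA := measurable_has_red M i.
by apply: measurableU; [exact: measurableC|exact: measurable_red_pos].
Qed.

Lemma measurable_no_red s : measurable (no_red s).
Proof.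
apply: measurable_forall => i.
exact: (measurable_red_in i [set k | (count_mem i s < k)%N]).
Qed.

Lemma measurable_red_next i k s : measurable (red_next i k s).
Proof.
rewrite (_ : red_next i k s = has_red M i `&`
    [set w | forall j, has_red M j w ->
      (if j == i then [set k] else [set n | (count_mem j s < n)%N])
        (red_pos M j w)]); last first.
  apply/seteqP; split => w /= [Aw].
    move=> posk later; split=> // j; case: eqVneq => [-> _//|]; exact: later.
  move=> H; split=> //; first by have := H i Aw; rewrite eqxx.
  by move=> j ji Aj; have := H j Aj; rewrite (negPf ji).
apply: measurableI; first exact: measurable_has_red.
by apply: measurable_forall => j; exact: measurable_red_in.
Qed.

Lemma measurable_red_urns U : measurable (red_urns (has_red M) U).
Proof.
apply: measurable_forall => i.
have [iU|iU] := boolP (i \in U).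
  rewrite (_ : (fun _ => _) = has_red M i); first exact: measurable_has_red.
  by apply/seteqP; split => w /=; [case=> _ /(_ isT)|move=> Aw; split].
rewrite (_ : (fun _ => _) = ~` has_red M i).
  by apply: measurableC; exact: measurable_has_red.
by apply/seteqP; split => w /=; [case=> + _ => /[apply]|move=> Aw; split].
Qed.

Lemma total_probability (E : set T) : measurable E ->
  P E = (\sum_(U \in [set: {set V}]) P (E `&` red_urns (has_red M) U))%E.
Proof.
move=> mE.
have {1}-> : E = \bigcup_(U in [set: {set V}]) (E `&` red_urns (has_red M) U).
  apply/seteqP; split => w; last by case=> U _ [].
  move=> Ew; exists [set i | `[< has_red M i w >]]%SET => //; split => // i.
  by rewrite inE; split => /asboolP.
rewrite measure_fin_bigcup //; first exact: finite_finset.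
  apply/trivIsetP => U U' _ _ UU'; rewrite -subset0 => w.
  move=> [[_ wU] [_ wU']]; case/eqP: UU'; apply/setP => i.
  by apply/idP/idP => [/(wU i).2/(wU' i).1|/(wU' i).2/(wU i).1].
by move=> U _; apply: measurableI => //; exact: measurable_red_urns.
Qed.

(** Conditionally on the set of red urns, the probability factors over the urns,
    the factor of i is 1 / N_i whatever k is, and k does not occur in the other
    factors.  Sets of red urns that omit i or have probability zero contribute
    nothing for any k. *)
Lemma red_next_uniform i k k' s :
  (1 <= k <= urn_size M i)%N -> (1 <= k' <= urn_size M i)%N ->
  P (red_next i k s) = P (red_next i k' s).
Proof.
move=> hk hk'; rewrite !total_probability; try exact: measurable_red_next.
apply: eq_fsbigr => U _; set EU := red_urns _ U.
have mEU : measurable EU by exact: measurable_red_urns.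
have [iU|iU] := boolP (i \in U); last first.
  have empty l : red_next i l s `&` EU = set0.
    rewrite -subset0 => w [[Aw _ _] wU].
    by have := (wU i).1 Aw; rewrite (negPf iU).
  by rewrite !empty.
have [PU|PU] := ltP 0%E (P EU); last first.
  have null l : P (red_next i l s `&` EU) = 0%E.
    apply/eqP; rewrite eq_le measure_ge0 andbT; apply: le_trans PU.
    by apply: measureIr => //; exact: measurable_red_next.
  by rewrite !null.
pose B l j := if j == i then [set l] else [set n | (count_mem j s < n)%N].
have nextE l : red_next i l s `&` EU =
    [set w | forall j, j \in U -> B l j (red_pos M j w)] `&` EU.
  apply/seteqP; split => w [H wU]; split => //.
    case: H => Aw posl later j /(wU j).2 Aj; rewrite /B.
    by case: eqVneq => [->//|ji]; exact: later.
  split; first exact: (wU i).2.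
    by have := H i iU; rewrite /B eqxx.
  by move=> j ji /(wU j).1 /H; rewrite /B (negPf ji).
have condE l : (1 <= l <= urn_size M i)%N ->
    cond_prob P EU [set w | forall j, j \in U -> B l j (red_pos M j w)] =
    (urn_size M i)%:R^-1 * \prod_(j in U | j != i)
      cond_prob P EU [set w | (count_mem j s < red_pos M j w)%N].
  move=> hl; rewrite red_pos_indep // (bigD1 i) //= {1}/B eqxx.
  rewrite -(red_pos_uniform PU iU hl); congr (_ * _).
  by apply: eq_bigr => j /andP[_ ji]; rewrite /B (negPf ji).
have finU : fine (P EU) != 0.
  by rewrite gt_eqF // fine_gt0 // PU /= ltey_eq fin_num_measure.
have fineE l : fine (P (red_next i l s `&` EU)) =
    fine (P EU) *
    cond_prob P EU [set w | forall j, j \in U -> B l j (red_pos M j w)].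
  by rewrite nextE /cond_prob mulrCA divff ?mulr1.
have mnext l : measurable (red_next i l s `&` EU).
  by apply: measurableI => //; exact: measurable_red_next.
rewrite -[LHS]fineK ?fin_num_measure// -[RHS]fineK ?fin_num_measure//.
by rewrite !fineE !condE.
Qed.

Lemma no_red_rcons s i :
  P (no_red s) =
  (P (no_red (rcons s i)) + P (red_next i (count_mem i s).+1 s))%E.
Proof.
have cnt j : count_mem j (rcons s i) = (count_mem j s + (i == j))%N.
  by rewrite -cats1 count_cat /= addn0.
rewrite -measureU; [|exact: measurable_no_red|exact: measurable_red_next|].
  congr (P _); apply/seteqP; split => w.
    move=> H; have [[Aw posi]|nhit] :=
      pselect (has_red M i w /\ red_pos M i w = (count_mem i s).+1).
      by right; split => // j _; exact: H.
    left=> j Aj; rewrite cnt; have := H j Aj.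
    case: eqVneq => [ij|]; last by rewrite addn0.
    subst j; rewrite addn1 leq_eqVlt => /predU1P[posi|//].
    by case: nhit; split.
  case=> [H j Aj|[Ai posi later] j Aj].
    by apply: leq_ltn_trans (H j Aj); rewrite cnt leq_addr.
  by have [->|ji] := eqVneq j i; [rewrite posi|exact: later].
rewrite -subset0 => w [H [Ai posi _]].
by have := H i Ai; rewrite cnt eqxx posi addn1 ltnn.
Qed.

Definition no_red_prob s : R := fine (P (no_red s)).

Lemma no_red_probE s : (no_red_prob s)%:E = P (no_red s).
Proof.
rewrite /no_red_prob fineK // fin_num_measure //; exact: measurable_no_red.
Qed.

Lemma no_red_prob_perm s s' : perm_eq s s' -> no_red_prob s = no_red_prob s'.
Proof.
move=> /permP pe; rewrite /no_red_prob; congr (fine (P _)).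
by apply/seteqP; split => w H j /H; rewrite pe.
Qed.

Lemma no_red_prob_drop i s :
  no_red_prob s - no_red_prob (rcons s i) =
  fine (P (red_next i (count_mem i s).+1 s)).
Proof.
rewrite /no_red_prob (no_red_rcons s i) fineD ?fin_num_measure //.
- by rewrite addrC addKr.
- exact: measurable_no_red.
- exact: measurable_red_next.
Qed.

(** Uniformity replaces the position of the red marble of i in the drop after s'
    by the one in the drop after s; then the two events are nested. *)
Lemma no_red_prob_diminishing i s s' :
  (count_mem i s < urn_size M i)%N -> (count_mem i s' < urn_size M i)%N ->
  (forall j, j != i -> count_mem j s <= count_mem j s')%N ->
  no_red_prob s' - no_red_prob (rcons s' i) <=
  no_red_prob s - no_red_prob (rcons s i).
Proof.
move=> si s'i ss'; rewrite !no_red_prob_drop.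
rewrite (@red_next_uniform _ _ (count_mem i s).+1 s') //.
have mnext r : measurable (red_next i (count_mem i s).+1 r).
  exact: measurable_red_next.
rewrite fine_le ?fin_num_measure // le_measure ?inE // => w [Aw posi later].
split=> // j ji Aj; apply: leq_ltn_trans (later j ji Aj); exact: ss'.
Qed.

(** * Policies as words *)

Definition word_of (u : policy M) : seq V :=
  [seq u t | t <- enum 'I_(nb_marbles M)].

Lemma size_word_of u : size (word_of u) = nb_marbles M.
Proof. by rewrite size_map size_enum_ord. Qed.

Lemma nth_word_of v0 u (t : 'I_(nb_marbles M)) : nth v0 (word_of u) t = u t.
Proof. by rewrite (nth_map t) ?size_enum_ord // nth_ord_enum. Qed.

Lemma count_word_of u i : count_mem i (word_of u) = #|[pred t | u t == i]|.
Proof.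
rewrite count_map enumT cardE size_filter; apply: eq_count => t.
by rewrite /= inE.
Qed.

Lemma count_take_word_of u i (t : 'I_(nb_marbles M)) :
  count_mem i (take t.+1 (word_of u)) =
  #|[pred r : 'I_(nb_marbles M) | (r <= t)%N && (u r == i)]|.
Proof.
rewrite -map_take count_map take_enum_ord // count_filter.
rewrite enumT cardE size_filter; apply: eq_count => r.
by rewrite !inE /= andbC ltnS.
Qed.

Lemma draw_rankE (u : policy M) (t : 'I_(nb_marbles M)) :
  draw_rank u t = count_mem (u t) (take t.+1 (word_of u)).
Proof. by rewrite count_take_word_of. Qed.

(** The draws of an urn up to stage t examine the ranks 1, ..., n of its draw
    order, each exactly once, where n is the number of queries of that urn so
    far; hence the red marble has been drawn iff its position is at most n. *)
Lemma searching_no_red (u : policy M) w (t : 'I_(nb_marbles M)) :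
  reaches u w t && ~~ draws_red u w t =
  (w \in no_red (take t.+1 (word_of u))).
Proof.
have -> : reaches u w t && ~~ draws_red u w t =
    [forall s : 'I_(nb_marbles M), (s <= t)%N ==> ~~ draws_red u w s].
  apply/andP/forallP => [[/forallP ru nt] s|H].
    apply/implyP; rewrite leq_eqVlt => /predU1P[/val_inj->//|].
    exact: (implyP (ru s)).
  split; last exact: (implyP (H t)).
  by apply/forallP => s; apply/implyP => st; apply: (implyP (H s)); exact: ltnW.
apply/forallP/idP => [H|/set_mem H s].
  apply/mem_set => i Ai; rewrite ltnNge; apply/negP => le.
  have [/andP[pos1 _]] := red_pos_range Ai.
  have [|k []] := @count_reached _ (take t.+1 (word_of u)) i (red_pos M i w).
    by rewrite pos1.
  rewrite size_take size_word_of => kt.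
  have kt1 : (k < t.+1)%N by move: kt; case: ifP => //; lia.
  have kN : (k < nb_marbles M)%N by apply: leq_trans kt1 _.
  rewrite nth_take // -[k]/(val (Ordinal kN)) nth_word_of => uk.
  rewrite take_takel // => ck.
  have := implyP (H (Ordinal kN)) kt1.
  by rewrite /draws_red uk draw_rankE uk ck eqxx mem_set.
apply/implyP => st; rewrite /draws_red; apply/negP => /andP[/set_mem As /eqP ps].
have := H _ As; rewrite ltnNge ps draw_rankE => /negP; apply.
rewrite -[in leqRHS](cat_take_drop s.+1 (take _ _)) take_takel //.
by rewrite count_cat leq_addr.
Qed.

Lemma expected_costE (u : policy M) :
  expected_cost u = (search_cost no_red_prob [::] (word_of u))%:E.
Proof.
rewrite /expected_cost unlock.
pose E (t : 'I_(nb_marbles M)) := no_red (take t.+1 (word_of u)).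
have mE t : measurable (E t) by exact: measurable_no_red.
transitivity (\int[P]_w \sum_(t < nb_marbles M) (\1_(E t) w)%:E)%E.
  apply: eq_integral => w _; rewrite sumEFin; congr (_%:E).
  rewrite /cost -sum1_card natr_sum big_mkcond; apply: eq_bigr => t _.
  by rewrite inE searching_no_red indicE; case: ifP.
rewrite ge0_integral_sum //; last first.
  by move=> t; apply/measurable_EFinP; exact: measurable_indic.
rewrite /search_cost size_word_of -sumEFin; apply: eq_bigr => t _.
by rewrite integral_indic // setIT no_red_probE.
Qed.

Let v0 : V.
Proof. by have /card_gt0P/sigW[v _] := urns_nonempty M; exact: v. Qed.

(** The default urn v0 matters only for words shorter than the number of
    marbles. *)
Definition policy_of s : policy M := [ffun t : 'I_(nb_marbles M) => nth v0 s t].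

Lemma policy_ofK s : size s = nb_marbles M -> word_of (policy_of s) = s.
Proof.
move=> szs; apply: (@eq_from_nth _ v0) => [|k]; rewrite size_word_of // => kN.
by rewrite -[k]/(val (Ordinal kN)) nth_word_of ffunE.
Qed.

Lemma size_of_counts s : (forall i, count_mem i s = urn_size M i) ->
  size s = nb_marbles M.
Proof.
move=> cs; rewrite /nb_marbles -(eq_bigr _ (fun i _ => cs i)).
elim: s {cs} => [|x s IH]; first by rewrite big1.
rewrite /= IH big_split /= -[in LHS]add1n; congr addn.
rewrite (bigD1 x) //= eqxx big1 // => i ix.
by rewrite eq_sym (negPf ix).
Qed.

Lemma valid_policy_of s : (forall i, count_mem i s = urn_size M i) ->
  valid_policy (policy_of s).
Proof.
by move=> cs i; rewrite -count_word_of policy_ofK ?cs // size_of_counts.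
Qed.

Lemma block_policy_of vs : uniq vs -> (forall i, i \in vs) ->
  block_policy (policy_of (block_word (urn_size M) vs)).
Proof.
move=> uvs vsT.
have szvs : size vs = #|V|.
  by rewrite -(card_uniqP uvs); apply: eq_card => i; rewrite vsT.
split; first by apply: valid_policy_of => i; exact: count_block_word.
exists (fun k : 'I_#|V| => nth v0 vs k); split.
  apply: inj_card_bij; last by rewrite card_ord.
  move=> k l /eqP; rewrite nth_uniq ?szvs // => /eqP; exact: val_inj.
move=> i t; rewrite ffunE => ht; apply: nth_block_word; first by rewrite szvs.
have sumE k : (k <= #|V|)%N -> (\sum_(v <- take k vs) urn_size M v =
    \sum_(j < #|V| | j < k) urn_size M (nth v0 vs j))%N.
  move=> kV; rewrite (big_nth v0) size_take_min szvs (minn_idPl kV).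
  rewrite big_mkord.
  rewrite (big_ord_widen _ (fun l => urn_size M (nth v0 (take k vs) l)) kV).
  by apply: eq_bigr => j jk; rewrite nth_take.
rewrite !sumE //; exact: ltnW.
Qed.

End Urns.

Theorem theorem2 (d : measure_display) (T : measurableType d) (R : realType)
    (P : probability T R) (V : finType) (M : urn_problem P V) :
  exists u : policy M, optimal_policy u /\ block_policy u.
Proof.
pose search (u : policy M) := search_cost (no_red_prob M) [::] (word_of u).
pose valid (u : policy M) := [forall i, #|[pred t | u t == i]| == urn_size M i].
have validP u : reflect (valid_policy u) (valid u).
  by apply: (iffP forallP) => H i; apply/eqP; exact: H.
have valid0 : valid (policy_of M (block_word (urn_size M) (enum V))).
  apply/validP/valid_policy_of => i.
  by rewrite count_block_word ?enum_uniq ?mem_enum.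
have [u /validP uv umin] := Order.TotalTheory.arg_minP search valid0.
have [i|vs [uvs vsT le]] := exists_block_word_le (@no_red_prob_perm _ _ _ _ _ M)
  (@no_red_prob_diminishing _ _ _ _ _ M) (@urn_size_gt0 _ _ _ _ _ M)
  (s := word_of u).
  by rewrite count_word_of uv.
have bu := block_policy_of M uvs vsT.
exists (policy_of M (block_word (urn_size M) vs)); split=> //.
split=> [|u' /validP u'v]; first exact: bu.1.
rewrite !expected_costE lee_fin policy_ofK.
  exact: le_trans le (umin u' u'v).
by apply: size_of_counts => i; exact: count_block_word.
Qed.
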